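(* Let $\frac12\le p\le 1$. For the online problem Edge-2-Coloring(Path), the randomized algorithm $\mathrm{RP}_p$ has competitive ratio $$C_{\mathrm{RP}_p}^{\text{Path}}(2)=\min\left\{p^2-p+1,\ \tfrac23(-p^2+p+1)\right\}.$$
   Context: Online dual edge coloring, Edge-$k$-Coloring: a number $k$ of colors $1,\dots,k$ is given. The edges of a simple graph arrive one by one, each specified by its two endpoints. Upon arrival, an edge must irrevocably either be colored with one of the $k$ colors, such that no two adjacent (sharing an endpoint) colored edges receive the same color, or be rejected. The goal is to color as many edges as possible. Edge-2-Coloring(Path) is the case $k=2$ with the input graph being a path. Competitive ratio of a randomized algorithm: for an input sequence $\sigma$, let $E[\mathrm{ALG}(\sigma)]$ be the expected number of edges colored and $\mathrm{OPT}(\sigma)$ the maximum number of edges of the input graph that can be properly colored with $k$ colors. ALG is $C$-competitive if there is a constant $b$ with $E[\mathrm{ALG}(\sigma)]\ge C\cdot\mathrm{OPT}(\sigma)-b$ for all inputs $\sigma$; the competitive ratio is the supremum of all such $C$. An isolated edge is an edge $(u,v)$ such that, at the time it is revealed, no previously revealed edge is incident to $u$ or $v$. The algorithm $\mathrm{RP}_p$ (for $\frac12\le p\le1$): whenever an isolated edge is revealed, it colors it with color 1 with probability $p$ and with color 2 with probability $1-p$; every non-isolated edge is colored with the remaining available color if possible, and rejected otherwise. *)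

(* Defs.v *)
From mathcomp Require Import all_boot all_order all_algebra.
From mathcomp Require Import all_classical all_reals all_analysis.

Set Implicit Arguments.
Unset Strict Implicit.
Unset Printing Implicit Defensive.

Import Order.TTheory GRing.Theory Num.Theory.

Local Open Scope classical_set_scope.
Local Open Scope ring_scope.

(* Vertices are natural numbers. An edge is given by its two endpoints, whose
   order is irrelevant. *)
Definition edge : Type := (nat * nat)%type.

Definition unordered (e : edge) : edge := (minn e.1 e.2, maxn e.1 e.2).

Definition incident (e f : edge) : bool :=
  [|| e.1 == f.1, e.1 == f.2, e.2 == f.1 | e.2 == f.2].

(* The arrival order is arbitrary: only the final graph has to be a path, each
   edge of which is revealed exactly once. *)
Definition path_input (sigma : seq edge) : Prop :=
  exists2 vs : seq nat, uniq vs
    & perm_eq (map unordered sigma) (map unordered (zip vs (behead vs))).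

(* [None] stands for a rejected (uncolored) edge. *)
Definition proper_coloring (k : nat) (sigma : seq edge)
    (c : {ffun 'I_(size sigma) -> option 'I_k}) : bool :=
  [forall i, forall j,
     [&& i != j, c i != None
       & incident (tnth (in_tuple sigma) i) (tnth (in_tuple sigma) j)]
     ==> (c i != c j)].

Definition OPT (k : nat) (sigma : seq edge) : nat :=
  \max_(c : {ffun 'I_(size sigma) -> option 'I_k} | proper_coloring c)
    #|[pred i | c i != None]|.

(* The revealed edges, in order of arrival, with the decisions taken. *)
Definition history (k : nat) : Type := seq (edge * option 'I_k).

(* [A h e d] is the conditional probability, given the history [h], of taking
   decision [d] on the newly revealed edge [e]. *)
Definition online_algorithm (R : realType) (k : nat) : Type :=
  history k -> edge -> option 'I_k -> R.

Definition available (k : nat) (h : history k) (e : edge) : pred 'I_k :=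
  [pred c | all (fun x => incident x.1 e ==> (x.2 != Some c)) h].

Definition valid_algorithm (R : realType) (k : nat)
    (A : online_algorithm R k) : Prop :=
  forall (h : history k) (e : edge),
    [/\ forall d, 0 <= A h e d,
        \sum_(d : option 'I_k) A h e d = 1
      & forall c, A h e (Some c) != 0 -> c \in available h e].

Fixpoint run_prob (R : realType) (k : nat) (A : online_algorithm R k)
    (h : history k) (sigma : seq edge) (ds : seq (option 'I_k)) : R :=
  match sigma, ds with
  | e :: sigma', d :: ds' => A h e d * run_prob A (rcons h (e, d)) sigma' ds'
  | _, _ => 1
  end.

Definition expected_colored (R : realType) (k : nat)
    (A : online_algorithm R k) (sigma : seq edge) : R :=
  \sum_(ds : (size sigma).-tuple (option 'I_k))
    run_prob A [::] sigma ds * (count isSome ds)%:R.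

Definition competitive (R : realType) (k : nat) (inputs : seq edge -> Prop)
    (A : online_algorithm R k) (C : R) : Prop :=
  exists b : R, forall sigma : seq edge, inputs sigma ->
    C * (OPT k sigma)%:R - b <= expected_colored A sigma.

(* The supremum is taken in the extended reals, so that no convention about
   unbounded sets is involved. *)
Definition competitive_ratio (R : realType) (k : nat)
    (inputs : seq edge -> Prop) (A : online_algorithm R k) : \bar R :=
  ereal_sup [set C%:E | C in [set C : R | competitive inputs A C]].

Definition isolated (k : nat) (h : history k) (e : edge) : bool :=
  all (fun x => ~~ incident x.1 e) h.

Definition color1 : 'I_2 := ord0.
Definition color2 : 'I_2 := ord_max.

(* On a path, a non-isolated edge always has a colored neighbor (an edge is
   rejected only after both its neighbors have been revealed), so that at most
   one color is available and [pick] makes no arbitrary choice. *)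
Definition RP (R : realType) (p : R) : online_algorithm R 2 :=
  fun h e d =>
    if isolated h e then
      if d == Some color1 then p
      else if d == Some color2 then 1 - p
      else 0
    else (d == [pick c | c \in available h e])%:R.

Lemma RP_valid (R : realType) (p : R) :
  0 <= p -> p <= 1 -> valid_algorithm (RP p).
Proof.
move=> p0 p1 h e; rewrite /RP; case: (boolP (isolated h e)) => [iso|_]; split.
- move=> d; case: ifP => // _.
  by case: ifP => // _; rewrite subr_ge0.
- rewrite (bigD1 (Some color1)) //= (bigD1 (Some color2)) //= big1 /=.
    by rewrite addr0 addrC subrK.
  by move=> d /andP[/negbTE -> /negbTE ->].
- move=> c _; apply/allP => x xh.
  by rewrite (negbTE (allP iso x xh)).
- by move=> d; rewrite ler0n.
- case: pickP => [c _|_].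
    by rewrite (bigD1 (Some c)) //= eqxx big1 ?addr0 // => d /negbTE ->.
  by rewrite (bigD1 None) //= big1 ?addr0 // => d /negbTE ->.
- move=> c; case: pickP => [c' Hc'|_]; last by rewrite eqxx.
  by case: (Some c =P Some c') => [[->] //|_]; rewrite eqxx.
Qed.

(* Main.v *)
Require Import Defs.
From mathcomp Require Import all_boot all_order all_algebra.
From mathcomp Require Import all_classical all_reals all_analysis.
From mathcomp Require Import zify ring lra.

Import Order.TTheory GRing.Theory Num.Theory.

Local Open Scope ring_scope.

(** On a path, label edges by position and let [T j] be the arrival time of the
    [j]-th edge. The isolated edges are the local minima of [T] and the only
    edges that can be rejected are its local maxima ("peaks"). Along a monotone
    run of [T] the colors alternate, so the color next to a peak is determined
    by the color of the local minimum at the foot of that slope: writing [l] and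
    [r] for the two feet of a peak, it is rejected iff the independent colors of
    [l] and [r] agree or differ according to the parity of [r - l]. The expected
    number of rejections is thus a sum over peaks of a probability depending
    only on the parity of [r - l]. The intervals from [l] to [r] do not overlap
    and [r - l >= 2], so the worst cases are [r - l = 2] and [r - l = 3]
    throughout, and both are realized by periodic arrival orders. *)

(** * Means over the random decisions of an online algorithm *)

(** Generalizes [expected_colored] to an arbitrary history, so that induction on the input is
    possible. *)
Definition run_mean {R : realType} {k : nat} (A : online_algorithm R k)
    (h : history k) (sigma : seq edge) (F : seq (option 'I_k) -> R) : R :=
  \sum_(ds : (size sigma).-tuple (option 'I_k)) run_prob A h sigma ds * F ds.

Lemma big_tuple_cons {R : realType} {T : finType} (n : nat)
    (F : seq T -> R) :
  \sum_(ds : n.+1.-tuple T) F ds =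
  \sum_(d : T) \sum_(ds : n.-tuple T) F (d :: ds).
Proof.
rewrite pair_big /= (reindex (fun x : T * n.-tuple T => [tuple of x.1 :: x.2])) //.
exists (fun t => (thead t, [tuple of behead t])) => [[d ds] _|t _] /=.
  by rewrite theadE; congr pair; apply: val_inj.
by rewrite -tuple_eta.
Qed.

Lemma run_mean_cons {R : realType} {k : nat} (A : online_algorithm R k)
    (h : history k) (e : edge) (sigma : seq edge)
    (F : seq (option 'I_k) -> R) :
  run_mean A h (e :: sigma) F =
  \sum_d A h e d *
    run_mean A (rcons h (e, d)) sigma (fun ds => F (d :: ds)).
Proof.
rewrite /run_mean.
rewrite (big_tuple_cons _ (fun ds => run_prob A h (e :: sigma) ds * F ds)) /=.
by apply: eq_bigr => d _; rewrite mulr_sumr; apply: eq_bigr => ds _; rewrite mulrA.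
Qed.

Lemma run_mean_nil {R : realType} {k : nat} (A : online_algorithm R k)
    (h : history k) (F : seq (option 'I_k) -> R) :
  run_mean A h [::] F = F [::].
Proof.
rewrite /run_mean (big_pred1 [tuple]) ?mul1r // => ds.
by apply/esym/eqP; exact: tuple0.
Qed.

Lemma run_mean_sum {R : realType} {k : nat} (A : online_algorithm R k)
    (h : history k) (sigma : seq edge) (I : Type) (r : seq I) (P : pred I)
    (F : I -> seq (option 'I_k) -> R) :
  run_mean A h sigma (fun ds => \sum_(i <- r | P i) F i ds) =
  \sum_(i <- r | P i) run_mean A h sigma (F i).
Proof.
rewrite /run_mean exchange_big /=.
by apply: eq_bigr => ds _; rewrite mulr_sumr.
Qed.

Lemma run_meanB {R : realType} {k : nat} (A : online_algorithm R k)
    (h : history k) (sigma : seq edge) (F G : seq (option 'I_k) -> R) :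
  run_mean A h sigma (fun ds => F ds - G ds) =
  run_mean A h sigma F - run_mean A h sigma G.
Proof.
by rewrite /run_mean -sumrB; apply: eq_bigr => ds _; rewrite mulrBr.
Qed.

Lemma run_meanZ {R : realType} {k : nat} (A : online_algorithm R k)
    (h : history k) (sigma : seq edge) (a : R)
    (F : seq (option 'I_k) -> R) :
  run_mean A h sigma (fun ds => a * F ds) = a * run_mean A h sigma F.
Proof.
by rewrite /run_mean mulr_sumr; apply: eq_bigr => ds _; rewrite mulrCA.
Qed.

Lemma run_mean_cst {R : realType} {k : nat} (A : online_algorithm R k)
    (h : history k) (sigma : seq edge) (a : R) :
  valid_algorithm A -> run_mean A h sigma (fun=> a) = a.
Proof.
move=> vA; elim: sigma h => [|e sigma IH] h; first by rewrite run_mean_nil.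
rewrite run_mean_cons; under eq_bigr do rewrite IH.
by rewrite -mulr_suml; have [_ -> _] := vA h e; rewrite mul1r.
Qed.

Lemma eq_run_mean {R : realType} {k : nat} (A : online_algorithm R k)
    (h : history k) (sigma : seq edge) (F G : seq (option 'I_k) -> R) :
  (forall ds, size ds = size sigma -> run_prob A h sigma ds != 0 ->
    F ds = G ds) ->
  run_mean A h sigma F = run_mean A h sigma G.
Proof.
move=> FG; apply: eq_bigr => ds _.
have [->|ds0] := eqVneq (run_prob A h sigma ds) 0; first by rewrite !mul0r.
by rewrite FG // size_tuple.
Qed.

(** A nonzero product has nonzero factors. Together with [eq_run_mean], this lets deterministic
    facts about the decisions of [RP] be used under the mean. *)
Lemma run_prob_neq0 {R : realType} {k : nat} (A : online_algorithm R k)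
    (h : history k) (sigma : seq edge) (ds : seq (option 'I_k)) (e0 : edge)
    (t : nat) :
  size ds = size sigma -> run_prob A h sigma ds != 0 -> (t < size sigma)%N ->
  A (h ++ zip (take t sigma) (take t ds)) (nth e0 sigma t) (nth None ds t)
    != 0.
Proof.
elim: sigma h ds t => [|e sigma IH] h [|d ds] t //= [sz].
rewrite mulf_eq0 negb_or => /andP[Ad rn].
case: t => [|t] lt /=; first by rewrite cats0.
by rewrite -cat_rcons; apply: IH.
Qed.

(* [Defs.isolated] at time [t], which depends on the edges only and not on the
   decisions; [es] are the edges revealed before [sigma]. *)
Definition isolated_at (es sigma : seq edge) (t : nat) : bool :=
  all (fun x => ~~ incident x (nth (0, 0)%N sigma t)) (es ++ take t sigma).

Lemma run_mean_isolated {R : realType} (p : R) (h : history 2)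
    (sigma : seq edge) (t : nat) (f : option 'I_2 -> R) :
  0 <= p -> p <= 1 -> (t < size sigma)%N ->
  isolated_at (map fst h) sigma t ->
  run_mean (RP p) h sigma (fun ds => f (nth None ds t)) =
  p * f (Some color1) + (1 - p) * f (Some color2).
Proof.
move=> p0 p1; elim: sigma h t => [|e sigma IH] h [|t] //= lt iso.
  rewrite run_mean_cons /=; under eq_bigr do
    rewrite (run_mean_cst _ _ _ _ (RP_valid p0 p1)).
  have isoh : Defs.isolated h e.
    by move: iso; rewrite /isolated_at /= cats0 all_map.
  rewrite /RP isoh (bigD1 (Some color1)) //= (bigD1 (Some color2)) //= big1.
    by rewrite addr0.
  by move=> d /andP[/negbTE -> /negbTE ->]; rewrite mul0r.
rewrite run_mean_cons /=.
under eq_bigr => d _.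
  rewrite IH //; first by over.
  by move: iso; rewrite /isolated_at /= map_rcons cat_rcons.
by rewrite -mulr_suml; have [_ -> _] := RP_valid p0 p1 h e; rewrite mul1r.
Qed.

(** Independence of the two colors: isolation depends on the edges alone, so conditioning on the
    decision at [s] leaves the law at [t] unchanged. *)
Lemma run_mean_isolated2 {R : realType} (p : R) (h : history 2)
    (sigma : seq edge) (s t : nat) (f g : option 'I_2 -> R) :
  0 <= p -> p <= 1 -> (s < t)%N -> (t < size sigma)%N ->
  isolated_at (map fst h) sigma s -> isolated_at (map fst h) sigma t ->
  run_mean (RP p) h sigma (fun ds => f (nth None ds s) * g (nth None ds t)) =
  (p * f (Some color1) + (1 - p) * f (Some color2)) *
  (p * g (Some color1) + (1 - p) * g (Some color2)).
Proof.
move=> p0 p1; elim: sigma h s t => [|e sigma IH] h s [|t] //= st lt isos isot.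
have isot' d : isolated_at (map fst (rcons h (e, d))) sigma t.
  by move: isot; rewrite /isolated_at /= map_rcons cat_rcons.
rewrite run_mean_cons /=.
case: s st isos => [|s] st isos /=.
  under eq_bigr do rewrite run_meanZ run_mean_isolated //.
  have isoh : Defs.isolated h e.
    by move: isos; rewrite /isolated_at /= cats0 all_map.
  rewrite /RP isoh (bigD1 (Some color1)) //= (bigD1 (Some color2)) //= big1.
    by rewrite addr0; ring.
  by move=> d /andP[/negbTE -> /negbTE ->]; rewrite mul0r.
under eq_bigr => d _.
  rewrite IH //; first by over.
  by move: isos; rewrite /isolated_at /= map_rcons cat_rcons.
by rewrite -mulr_suml; have [_ -> _] := RP_valid p0 p1 h e; rewrite mul1r.
Qed.

(** * Slopes, peaks and valleys of arrival times *)

Definition up (T : nat -> nat) (j : nat) : bool := (0 < j)%N && (T j.-1 < T j)%N.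

(** The right end is encoded in the times: [arrival] gives the position just past the path a time
    later than all others, so the last edge is not [down]. *)
Definition down (T : nat -> nat) (j : nat) : bool := (T j.+1 < T j)%N.

Definition peak (T : nat -> nat) (j : nat) : bool := up T j && down T j.

Definition valley (T : nat -> nat) (j : nat) : bool := ~~ up T j && ~~ down T j.

Fixpoint lroot (T : nat -> nat) (j : nat) : nat :=
  if j is i.+1 then (if (T i < T j)%N then lroot T i else j) else 0%N.

(* [m] is fuel: positions from [j] on that may still be visited. *)
Fixpoint rroot_rec (T : nat -> nat) (m j : nat) : nat :=
  if m is m'.+1 then (if down T j then rroot_rec T m' j.+1 else j) else j.

Definition rroot (T : nat -> nat) (n j : nat) : nat := rroot_rec T (n - j) j.

Lemma lrootE (T : nat -> nat) (j : nat) :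
  lroot T j = if up T j then lroot T j.-1 else j.
Proof. by case: j. Qed.

Lemma rrootE (T : nat -> nat) (n j : nat) : (j < n)%N ->
  rroot T n j = if down T j then rroot T n j.+1 else j.
Proof. by move=> jn; rewrite /rroot -(subSS j n) subSn. Qed.

Lemma lroot_le (T : nat -> nat) (j : nat) : (lroot T j <= j)%N.
Proof. by elim: j => //= j IH; case: ifP => // _; apply: leqW. Qed.

Lemma rroot_ge (T : nat -> nat) (n j : nat) : (j <= rroot T n j)%N.
Proof.
rewrite /rroot; move: (n - j)%N => m; elim: m j => //= m IH j; case: ifP => // _.
by apply: leq_trans (IH _).
Qed.

(** Each step of the walk goes to a smaller time, which preserves [~~ down]; the walk stops where
    [up] fails as well. *)
Lemma lroot_valley (T : nat -> nat) (j : nat) :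
  ~~ down T j -> valley T (lroot T j).
Proof.
elim: j => [|j IH] nd /=; first by rewrite /valley nd.
case: ifP => [lt|nlt]; last by rewrite /valley nd /up /= nlt.
by apply: IH; rewrite /down -leqNgt ltnW.
Qed.

(** The large time at [n] acts as a sentinel that stops the walk inside the path. *)
Lemma rroot_valley (T : nat -> nat) (n j : nat) :
  (forall i, (i < n)%N -> (T i < T n)%N) -> (j < n)%N ->
  ~~ up T j -> (rroot T n j < n)%N && valley T (rroot T n j).
Proof.
move=> Tn jn; have [m mE] : exists m, n = (j + m.+1)%N.
  by exists (n - j).-1; lia.
elim: m j mE jn => [|m IH] j mE jn nu; rewrite rrootE //; case: ifP => dj.
- have nE : n = j.+1 by lia.
  by move: dj (Tn j jn); rewrite nE /down => lt /ltn_trans/(_ lt); rewrite ltnn.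
- by rewrite jn /valley nu dj.
- apply: IH; [lia | lia | move: dj; rewrite /down /up /=; lia].
- by rewrite jn /valley nu dj.
Qed.

(** The left slopes of distinct peaks use distinct ascents. The term [n - lroot T n] counts the
    slope still in progress at [n] and makes the induction work. *)
Lemma sum_lroot (T : nat -> nat) (n : nat) :
  (\sum_(0 <= j < n | peak T j) (j - lroot T j) + (n - lroot T n) <=
   \sum_(0 <= j < n) (T j < T j.+1))%N.
Proof.
elim: n => [|n IH]; first by rewrite !big_geq.
rewrite big_mkcond big_nat_recr //= -big_mkcond /= big_nat_recr //=.
move: IH (lroot_le T n).
have -> : peak T n = up T n && (T n.+1 < T n)%N by [].
case: (ltngtP (T n) (T n.+1)) => _ /=; rewrite ?andbF ?andbT; [lia | | lia].
case: ifP; lia.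
Qed.

(** Mirror image with descents; the induction runs from the right end, and the extra term counts the
    slope that starts at [k]. *)
Lemma sum_rroot (T : nat -> nat) (n k : nat) : (k < n)%N ->
  (\sum_(k.+1 <= j < n | peak T j) (rroot T n j - j) + (rroot T n k - k) <=
   \sum_(k <= j < n) (T j.+1 < T j))%N.
Proof.
move=> kn; have [m mE] : exists m, n = (k + m.+1)%N by exists (n - k).-1; lia.
elim: m k mE kn => [|m IH] k mE kn.
  rewrite rrootE // big_geq ?(big_ltn kn) ?big_geq; try lia.
  rewrite -[(T k.+1 < T k)%N]/(down T k); case: ifP => _; last lia.
  by rewrite /rroot (_ : n - k.+1 = 0)%N /=; lia.
have kn1 : (k.+1 < n)%N by lia.
have {IH} := IH k.+1 ltac:(lia) kn1.
rewrite (big_ltn kn) (rrootE T n k) //.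
rewrite [X in _ -> (X + _ <= _)%N]big_ltn_cond //.
have -> : peak T k.+1 = up T k.+1 && down T k.+1 by [].
have := rroot_ge T n k.+1.
rewrite -[(T k.+1 < T k)%N]/(down T k).
case dk: (down T k); last by case: ifP; lia.
suff -> : up T k.+1 = false by rewrite /=; lia.
by move: dk; rewrite /up /down /=; lia.
Qed.

(** No step between neighboring positions is both an ascent and a descent, so the two slope counts
    together use each step at most once. *)
Lemma sum_rroot_lroot (T : nat -> nat) (n : nat) :
  (\sum_(0 <= j < n | peak T j) (rroot T n j - lroot T j) <= n)%N.
Proof.
case: n => [|n]; first by rewrite big_geq.
have L := sum_lroot T n.+1; have := sum_rroot T n.+1 0 isT.
have S : (\sum_(0 <= j < n.+1 | peak T j) (rroot T n.+1 j - lroot T j) =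
  \sum_(0 <= j < n.+1 | peak T j) (j - lroot T j) +
  \sum_(0 <= j < n.+1 | peak T j) (rroot T n.+1 j - j))%N.
  rewrite -big_split /=; apply: eq_bigr => j _.
  by have := lroot_le T j; have := rroot_ge T n.+1 j; lia.
have Z : (\sum_(0 <= j < n.+1) (T j.+1 < T j) +
    \sum_(0 <= j < n.+1) (T j < T j.+1) <= n.+1)%N.
  rewrite -big_split /= -[leqRHS]subn0 -[leqRHS]muln1 -sum_nat_const_nat.
  by apply: leq_sum => j _; lia.
(* Position 0 fails [up], hence is no peak. *)
have P0 : (\sum_(0 <= j < n.+1 | peak T j) (rroot T n.+1 j - j) =
           \sum_(1 <= j < n.+1 | peak T j) (rroot T n.+1 j - j))%N.
  by rewrite big_ltn_cond.
move: (rroot _ _ 0) P0 S L Z => r P0; rewrite P0; lia.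
Qed.

(** * Positions and arrival times on a path *)

(* [nth 0 pos t] is the position on the path of the edge revealed at time [t]. *)
Definition arrival_order (sigma : seq edge) (pos : seq nat) : Prop :=
  perm_eq pos (iota 0 (size sigma)) /\
  forall s t, (s < size sigma)%N -> (t < size sigma)%N ->
    incident (nth (0, 0)%N sigma s) (nth (0, 0)%N sigma t) =
    (nth 0 pos s <= (nth 0 pos t).+1)%N && (nth 0 pos t <= (nth 0 pos s).+1)%N.

Definition arrival (pos : seq nat) (j : nat) : nat := index j pos.

Lemma arrival_lt (sigma : seq edge) (pos : seq nat) (j : nat) :
  arrival_order sigma pos -> (arrival pos j < size sigma)%N = (j < size sigma)%N.
Proof.
case=> pm _; have := perm_size pm; rewrite size_iota => {1}<-.
by rewrite index_mem (perm_mem pm) mem_iota.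
Qed.

Lemma nth_arrival (sigma : seq edge) (pos : seq nat) (j : nat) :
  arrival_order sigma pos -> (j < size sigma)%N ->
  nth 0%N pos (arrival pos j) = j.
Proof. by case=> pm _ jn; rewrite nth_index // (perm_mem pm) mem_iota. Qed.

Lemma arrival_nth (sigma : seq edge) (pos : seq nat) (t : nat) :
  arrival_order sigma pos -> (t < size sigma)%N ->
  arrival pos (nth 0%N pos t) = t.
Proof.
case=> pm _ tn; rewrite /arrival index_uniq // ?(perm_uniq pm) ?iota_uniq //.
by rewrite (perm_size pm) size_iota.
Qed.

Lemma arrival_last (sigma : seq edge) (pos : seq nat) (j : nat) :
  arrival_order sigma pos -> (j < size sigma)%N ->
  (arrival pos j < arrival pos (size sigma))%N.
Proof.
move=> ao jn; apply: (@leq_trans (size sigma)); first by rewrite (arrival_lt _ _ _ ao).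
by rewrite leqNgt (arrival_lt _ _ _ ao) ltnn.
Qed.

Lemma down_lt (sigma : seq edge) (pos : seq nat) (j : nat) :
  arrival_order sigma pos -> (j < size sigma)%N -> down (arrival pos) j ->
  (j.+1 < size sigma)%N.
Proof.
move=> ao jn dj; rewrite -(arrival_lt _ _ _ ao); apply: leq_trans dj _.
by rewrite ltnW // (arrival_lt _ _ _ ao).
Qed.

(** The incident edges already revealed are those among positions [j - 1] and [j + 1] with an
    earlier time. [Q] is general because [pred0] yields isolation and [!= Some a] yields
    availability. *)
Lemma all_history (k : nat) (sigma : seq edge) (pos : seq nat)
    (ds : seq (option 'I_k)) (Q : pred (option 'I_k)) (j : nat) :
  arrival_order sigma pos -> size ds = size sigma -> (j < size sigma)%N ->
  let t := arrival pos j in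
  all (fun x => incident x.1 (nth (0, 0)%N sigma t) ==> Q x.2)
      (zip (take t sigma) (take t ds)) =
  (up (arrival pos) j ==> Q (nth None ds (arrival pos j.-1))) &&
  (down (arrival pos) j ==> Q (nth None ds (arrival pos j.+1))).
Proof.
move=> ao sz jn t.
have tn : (t < size sigma)%N by rewrite (arrival_lt _ _ _ ao).
have sz_t : size (take t sigma) = size (take t ds) by rewrite !size_take sz.
have tE : size (zip (take t sigma) (take t ds)) = t.
  by rewrite size_zip -sz_t minnn size_take tn.
have inc s : (s < t)%N -> incident (nth (0, 0)%N sigma s) (nth (0, 0)%N sigma t) =
    (nth 0 pos s <= j.+1)%N && (j <= (nth 0 pos s).+1)%N.
  by move=> st; rewrite ao.2 ?(nth_arrival _ _ _ ao) ?(ltn_trans st).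
apply/(all_nthP ((0, 0)%N, None))/andP; rewrite tE.
  move=> al; split; apply/implyP.
    case/andP=> j0 lt; have := al _ lt; rewrite nth_zip //= !nth_take // inc //.
    by rewrite (nth_arrival _ _ _ ao) ?(implyTb, andbT); [|lia]; case: andP => //; lia.
  move=> dj; have := al _ dj; rewrite nth_zip //= !nth_take // inc //.
  rewrite (nth_arrival _ _ _ ao); last exact: down_lt dj.
  by case: andP => //; lia.
case=> /implyP hu /implyP hd s st; rewrite nth_zip //= !nth_take // inc //.
apply/implyP => /andP[h1 h2]; have sn := ltn_trans st tn.
have sE := arrival_nth _ _ _ ao sn.
(* [incident] also holds between an edge and itself; that case contradicts [s < t]. *)
have [pj|[pj|pj]] : nth 0%N pos s = j \/ j = (nth 0%N pos s).+1 \/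
    nth 0%N pos s = j.+1 by lia.
- by move: st; rewrite -sE pj ltnn.
- have := hu; rewrite /up {3 4}pj /= sE; apply.
  by rewrite pj /= -pj sE.
- by have := hd; rewrite /down -pj sE; apply.
Qed.

Lemma isolated_valley (sigma : seq edge) (pos : seq nat) (j : nat) :
  arrival_order sigma pos -> (j < size sigma)%N ->
  isolated_at [::] sigma (arrival pos j) = valley (arrival pos) j.
Proof.
move=> ao jn; pose ds : seq (option 'I_2) := nseq (size sigma) None.
have sz : size ds = size sigma by rewrite size_nseq.
have := all_history 2 sigma pos ds pred0 j ao sz jn.
rewrite /= !implybF /valley => <-.
set t := arrival pos j; rewrite /isolated_at /=.
have {1}-> : take t sigma = map fst (zip (take t sigma) (take t ds)).
  by rewrite -/(unzip1 _) unzip1_zip // !size_take sz.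
by rewrite all_map; apply: eq_all => x /=; rewrite implybF.
Qed.

(** * Decisions of [RP] on slopes and at peaks *)

(* [color1] is [1], [color2] is [-1] and a rejected edge is [0]. *)
Definition sg {R : realType} (d : option 'I_2) : R :=
  (d == Some color1)%:R - (d == Some color2)%:R.

Lemma ord2_color (a : 'I_2) : a = color1 \/ a = color2.
Proof. by case: a => [[|[|//]]] i; [left | right]; apply: val_inj. Qed.

Lemma sg_mul {R : realType} (a b : 'I_2) :
  sg (Some a) * sg (Some b) = (-1) ^+ (a != b) :> R.
Proof.
by case: (ord2_color a) => ->; case: (ord2_color b) => ->; rewrite /sg /=;
  rewrite ?(subr0, sub0r, mulr1, mul1r, mulrNN).
Qed.

Lemma sg_neq {R : realType} (a b : 'I_2) :
  a != b -> sg (Some a) = - sg (Some b) :> R.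
Proof.
by case: (ord2_color a) => ->; case: (ord2_color b) => -> //= _;
  rewrite /sg /= ?(subr0, sub0r, opprK).
Qed.

Lemma RP_rule {R : realType} (p : R) (sigma : seq edge) (pos : seq nat)
    (ds : seq (option 'I_2)) (j : nat) :
  arrival_order sigma pos -> size ds = size sigma ->
  run_prob (RP p) [::] sigma ds != 0 -> (j < size sigma)%N ->
  let T := arrival pos in let c i := nth None ds (T i) in
  if valley T j then exists a, c j = Some a else
  c j = [pick a | (up T j ==> (c j.-1 != Some a)) &&
                  (down T j ==> (c j.+1 != Some a))].
Proof.
move=> ao sz rn jn T c.
have tn : (T j < size sigma)%N by rewrite (arrival_lt _ _ _ ao).
have := run_prob_neq0 _ _ _ _ (0, 0)%N _ sz rn tn.
rewrite /= /RP -/(c j).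
have -> : Defs.isolated (zip (take (T j) sigma) (take (T j) ds))
                   (nth (0, 0)%N sigma (T j)) = valley T j.
  rewrite /valley; have := all_history 2 sigma pos ds pred0 j ao sz jn.
  by rewrite /= !implybF => <-; apply: eq_all => x; rewrite implybF.
case: ifP => _; first by case: (c j) => [a _|]; [exists a | rewrite eqxx].
rewrite pnatr_eq0 eqb0 negbK => /eqP ->; apply: eq_pick => a.
exact: (all_history 2 sigma pos ds (fun d => d != Some a) j ao sz jn).
Qed.

(** Away from valleys and peaks, exactly one neighbor is earlier, and it blocks at most one of the
    two colors. *)
Lemma RP_colored {R : realType} (p : R) (sigma : seq edge) (pos : seq nat)
    (ds : seq (option 'I_2)) (j : nat) :
  arrival_order sigma pos -> size ds = size sigma ->
  run_prob (RP p) [::] sigma ds != 0 -> (j < size sigma)%N ->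
  ~~ peak (arrival pos) j -> exists a, nth None ds (arrival pos j) = Some a.
Proof.
move=> ao sz rn jn; have := RP_rule p sigma pos ds j ao sz rn jn.
have other (d : option 'I_2) : exists a, d != Some a.
  case: d => [a|]; last by exists color1.
  by case: (ord2_color a) => ->; [exists color2 | exists color1].
rewrite /peak /valley /=; case: (nth None ds _) => [a _ _|]; first by exists a.
case: (up _ j); case: (down _ j) => //=; try case: pickP => // no _ _.
- by have [a] := other (nth None ds (arrival pos j.-1)); rewrite -[_ != _]andbT no.
- by have [a] := other (nth None ds (arrival pos j.+1)); rewrite no.
Qed.

Lemma RP_up {R : realType} (p : R) (sigma : seq edge) (pos : seq nat)
    (ds : seq (option 'I_2)) (j : nat) :
  arrival_order sigma pos -> size ds = size sigma ->
  run_prob (RP p) [::] sigma ds != 0 -> (j < size sigma)%N ->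
  up (arrival pos) j -> ~~ down (arrival pos) j ->
  sg (nth None ds (arrival pos j)) = - sg (nth None ds (arrival pos j.-1)) :> R.
Proof.
move=> ao sz rn jn uj nd; have := RP_rule p sigma pos ds j ao sz rn jn.
(* The lower neighbor of [j] cannot be a peak, so it is colored. *)
have [b cb] : exists b, nth None ds (arrival pos j.-1) = Some b.
  apply: (RP_colored p) sz rn _ _ => //; first lia.
  by move: uj; rewrite /peak /up /down; case: j {jn nd} => //= j; lia.
have [a ca] : exists a, nth None ds (arrival pos j) = Some a.
  by apply: (RP_colored p) sz rn _ _ => //; rewrite /peak (negbTE nd) andbF.
rewrite /valley uj (negbTE nd) /= ca cb; case: pickP => // a' neq [->].
by apply: sg_neq; move: neq; rewrite andbT eq_sym.
Qed.

Lemma RP_down {R : realType} (p : R) (sigma : seq edge) (pos : seq nat)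
    (ds : seq (option 'I_2)) (j : nat) :
  arrival_order sigma pos -> size ds = size sigma ->
  run_prob (RP p) [::] sigma ds != 0 -> (j < size sigma)%N ->
  ~~ up (arrival pos) j -> down (arrival pos) j ->
  sg (nth None ds (arrival pos j)) = - sg (nth None ds (arrival pos j.+1)) :> R.
Proof.
move=> ao sz rn jn nu dj; have := RP_rule p sigma pos ds j ao sz rn jn.
have jn1 := down_lt _ _ _ ao jn dj.
have [b cb] : exists b, nth None ds (arrival pos j.+1) = Some b.
  apply: (RP_colored p) sz rn _ _ => //.
  by move: dj; rewrite /peak /up /down /=; lia.
have [a ca] : exists a, nth None ds (arrival pos j) = Some a.
  by apply: (RP_colored p) sz rn _ _ => //; rewrite /peak (negbTE nu).
rewrite /valley dj (negbTE nu) /= ca cb; case: pickP => // a' neq [->].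
by apply: sg_neq; move: neq; rewrite eq_sym.
Qed.

(** Both neighbors of a peak are colored, so a color remains exactly when theirs agree; the
    right-hand side is the indicator of opposite signs. *)
Lemma RP_peak {R : realType} (p : R) (sigma : seq edge) (pos : seq nat)
    (ds : seq (option 'I_2)) (j : nat) :
  arrival_order sigma pos -> size ds = size sigma ->
  run_prob (RP p) [::] sigma ds != 0 -> (j < size sigma)%N ->
  peak (arrival pos) j ->
  (nth None ds (arrival pos j) == None)%:R =
  (1 - sg (nth None ds (arrival pos j.-1)) *
       sg (nth None ds (arrival pos j.+1))) / 2 :> R.
Proof.
move=> ao sz rn jn /andP[uj dj]; have := RP_rule p sigma pos ds j ao sz rn jn.
have jn1 := down_lt _ _ _ ao jn dj.
have [a ca] : exists a, nth None ds (arrival pos j.-1) = Some a.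
  apply: (RP_colored p) sz rn _ _ => //; first lia.
  by move: uj; rewrite /peak /up /down; case: j {jn dj jn1} => //= j; lia.
have [b cb] : exists b, nth None ds (arrival pos j.+1) = Some b.
  apply: (RP_colored p) sz rn _ _ => //.
  by move: dj; rewrite /peak /up /down /=; lia.
rewrite /valley uj dj /= ca cb sg_mul => ->.
case: pickP => [d /andP[ad bd]|no] /=.
- have -> : a = b.
    by move: ad bd; case: (ord2_color a) => ->; case: (ord2_color b) => ->;
      case: (ord2_color d) => ->.
  by rewrite eqxx expr0 subrr mul0r.
- have -> : a != b.
    apply/eqP => ab; move: (no color1) (no color2); rewrite ab.
    by case: (ord2_color b) => ->.
  by rewrite expr1 opprK -[1 + 1]/(2%:R) divff // pnatr_eq0.
Qed.

(** * Expected number of rejections *)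

(* The sign of the color at position [j], twisted so that alternating colors
   along a slope become a constant. *)
Definition twisted {R : realType} (pos : seq nat) (j : nat)
    (ds : seq (option 'I_2)) : R :=
  (-1) ^+ j * sg (nth None ds (arrival pos j)).

Lemma twisted_lroot {R : realType} (p : R) (sigma : seq edge) (pos : seq nat)
    (ds : seq (option 'I_2)) (j : nat) :
  arrival_order sigma pos -> size ds = size sigma ->
  run_prob (RP p) [::] sigma ds != 0 -> (j < size sigma)%N ->
  ~~ down (arrival pos) j ->
  twisted pos j ds = twisted pos (lroot (arrival pos) j) ds :> R.
Proof.
move=> ao sz rn; elim: j => // j IH jn nd; rewrite lrootE; case: ifP => //= uj.
rewrite -IH; [|lia|by move: uj; rewrite /up /down /=; lia].
by rewrite /twisted (RP_up p _ _ _ _ ao sz rn jn uj nd) exprS; ring.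
Qed.

Lemma twisted_rroot {R : realType} (p : R) (sigma : seq edge) (pos : seq nat)
    (ds : seq (option 'I_2)) (j : nat) :
  arrival_order sigma pos -> size ds = size sigma ->
  run_prob (RP p) [::] sigma ds != 0 -> (j < size sigma)%N ->
  ~~ up (arrival pos) j ->
  twisted pos j ds =
  twisted pos (rroot (arrival pos) (size sigma) j) ds :> R.
Proof.
move=> ao sz rn jn; have [m mE] : exists m, size sigma = (j + m.+1)%N.
  by exists (size sigma - j).-1; lia.
elim: m j mE jn => [|m IH] j mE jn nu; rewrite rrootE //; case: ifP => // dj;
  have jn1 := down_lt _ _ _ ao jn dj; first lia.
rewrite -IH; [|lia|lia|by move: dj; rewrite /up /down /=; lia].
by rewrite /twisted (RP_down p _ _ _ _ ao sz rn jn nu dj) exprS; ring.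
Qed.

(* The twisted signs at two feet at distance [d] have a product of mean
   [(-1) ^+ d * (2 * p - 1) ^+ 2], and they differ exactly on rejection. *)
Definition reject_prob {R : realType} (p : R) (d : nat) : R :=
  (1 - (-1) ^+ d * (2 * p - 1) ^+ 2) / 2.

Lemma mean_reject {R : realType} (p : R) (sigma : seq edge) (pos : seq nat)
    (j : nat) :
  0 <= p -> p <= 1 -> arrival_order sigma pos -> (j < size sigma)%N ->
  let T := arrival pos in
  run_mean (RP p) [::] sigma (fun ds => (nth None ds (T j) == None)%:R) =
  (if peak T j then reject_prob p (rroot T (size sigma) j - lroot T j) else 0).
Proof.
move=> p0 p1 ao jn T; case: ifPn => pk; last first.
  rewrite -[RHS](run_mean_cst (RP p) [::] sigma 0 (RP_valid p0 p1)).
  apply: eq_run_mean => ds sz rn.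
  by have [a ->] := RP_colored p _ _ _ _ ao sz rn jn pk.
have /andP[uj dj] := pk.
have jn1 := down_lt _ _ _ ao jn dj.
have j0 : (0 < j)%N by case/andP: uj.
set l := lroot T j; set r := rroot T (size sigma) j.
have lE : l = lroot T j.-1 by rewrite /l lrootE uj.
have rE : r = rroot T (size sigma) j.+1 by rewrite /r rrootE // dj.
have nd : ~~ down T j.-1.
  by move: uj; rewrite /up /down (prednK j0); lia.
have nu : ~~ up T j.+1 by move: dj; rewrite /up /down /=; lia.
have lv : valley T l by rewrite lE; apply: lroot_valley.
have /andP[rn rv] : (r < size sigma)%N && valley T r.
  by rewrite rE; apply: rroot_valley => // i; apply: arrival_last.
have lr : (l < r)%N.
  by rewrite lE rE; have := lroot_le T j.-1; have := rroot_ge T (size sigma) j.+1; lia.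
have ln : (l < size sigma)%N by apply: ltn_trans rn.
transitivity (run_mean (RP p) [::] sigma (fun ds =>
   1 / 2 - (-1) ^+ (l + r) / 2 * (sg (nth None ds (T l)) * sg (nth None ds (T r))))).
  apply: eq_run_mean => ds sz run; rewrite (RP_peak p _ _ _ _ ao sz run jn pk).
  have tl := twisted_lroot p _ _ _ _ ao sz run (leq_ltn_trans (leq_pred j) jn) nd.
  have tr := twisted_rroot p _ _ _ _ ao sz run jn1 nu.
  (* The two twists cancel because [j.-1 + j.+1] is even. *)
  have -> : sg (nth None ds (arrival pos j.-1)) *
       sg (nth None ds (arrival pos j.+1)) =
       twisted pos j.-1 ds * twisted pos j.+1 ds :> R.
    rewrite /twisted mulrACA -exprD (_ : j.-1 + j.+1 = j * 2)%N; last lia.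
    by rewrite exprM sqrr_sign mul1r.
  by rewrite tl tr -/T -lE -rE /twisted exprD; field.
rewrite run_meanB run_mean_cst ?run_meanZ; last exact: RP_valid.
have iso i : (i < size sigma)%N -> valley T i -> isolated_at [::] sigma (T i).
  by move=> iN; rewrite (isolated_valley _ _ _ ao iN).
have -> : run_mean (RP p) [::] sigma
    (fun ds => sg (nth None ds (T l)) * sg (nth None ds (T r))) =
    (2 * p - 1) ^+ 2.
  (* [2 * p - 1] is the mean sign of an isolated edge. *)
  have sgE : p * sg (Some color1) + (1 - p) * sg (Some color2) = 2 * p - 1.
    by rewrite /sg /=; ring.
  (* Either foot may arrive first, while independence is stated for ordered times. *)
  have [lt|lt|eq] := ltngtP (T l) (T r).
  - by rewrite run_mean_isolated2 ?(arrival_lt _ _ _ ao) ?iso // sgE expr2.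
  - transitivity (run_mean (RP p) [::] sigma
      (fun ds => sg (nth None ds (T r)) * sg (nth None ds (T l)))).
      by apply: eq_run_mean => ds _ _; rewrite mulrC.
    by rewrite run_mean_isolated2 ?(arrival_lt _ _ _ ao) ?iso // sgE expr2.
  - have := nth_arrival _ _ _ ao ln; rewrite -/T eq (nth_arrival _ _ _ ao rn).
    by move=> rl; move: lr; rewrite rl ltnn.
rewrite /reject_prob; have -> : (-1) ^+ (l + r) = (-1) ^+ (r - l) :> R.
  by rewrite -signr_odd -[RHS]signr_odd oddB ?(ltnW lr) // oddD addbC.
by field.
Qed.

Lemma expected_RP {R : realType} (p : R) (sigma : seq edge) (pos : seq nat) :
  0 <= p -> p <= 1 -> arrival_order sigma pos ->
  let T := arrival pos in
  expected_colored (RP p) sigma = (size sigma)%:R -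
    \sum_(0 <= j < size sigma | peak T j)
       reject_prob p (rroot T (size sigma) j - lroot T j).
Proof.
move=> p0 p1 ao T; have pm := ao.1.
transitivity (run_mean (RP p) [::] sigma (fun ds => (size sigma)%:R -
  \sum_(0 <= j < size sigma) (nth None ds (T j) == None)%:R)).
  apply: (@eq_run_mean _ _ _ _ _ (fun ds => (count isSome ds)%:R)) => ds sz _.
  (* Rejections are recounted by time instead of position, through the permutation [pos]. *)
  have -> : \sum_(0 <= j < size sigma) (nth None ds (T j) == None)%:R =
      \sum_(0 <= t < size sigma) (nth None ds t == None)%:R :> R.
    rewrite {1}/index_iota subn0 -(perm_big _ pm) /= (big_nth 0%N).
    rewrite (perm_size pm) size_iota !big_nat.
    by apply: eq_bigr => t /andP[_ tn]; rewrite /T (arrival_nth _ _ _ ao tn).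
  rewrite -{1 2}sz -(big_nth None xpredT (fun d => (d == None)%:R)).
  elim: ds {sz} => [|d ds IH] /=; first by rewrite big_nil subr0.
  by rewrite big_cons natrD IH; case: d => [d|] /=; rewrite -(natr1 (size ds)); ring.
rewrite run_meanB run_mean_cst; last exact: RP_valid.
rewrite run_mean_sum [in RHS]big_mkcond /= !big_nat; congr (_ - _).
by apply: eq_bigr => j /andP[_ jn]; rewrite mean_reject.
Qed.

(** * Path inputs and their optimum *)

Lemma incident_unordered (e f : edge) :
  incident (unordered e) (unordered f) = incident e f.
Proof.
case: e => a b; case: f => c d; rewrite /incident /unordered /= /minn /maxn.
by case: (ltnP a b) => _; case: (ltnP c d) => _; lia.
Qed.

(** [pos] is the permutation relating [sigma] to the order along the path; edges match only up to
    orientation, so incidence is compared through [unordered]. *)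
Lemma path_input_arrival_order (sigma : seq edge) :
  path_input sigma -> exists pos, arrival_order sigma pos.
Proof.
case=> vs vs_uniq pm; set Z := zip vs (behead vs) in pm.
have sz : size sigma = size Z by have := perm_size pm; rewrite !size_map.
have /perm_iotaP - /(_ (0, 0)%N) [pos pm_pos posE] := pm.
rewrite size_map -sz in pm_pos; exists pos; split=> // s t sn tn.
have ltZ i : (i < size sigma)%N -> (nth 0%N pos i < size Z)%N.
  move=> iN; rewrite -sz.
  have : nth 0%N pos i \in pos by rewrite mem_nth // (perm_size pm_pos) size_iota.
  by rewrite (perm_mem pm_pos) mem_iota.
have unE i : (i < size sigma)%N ->
    unordered (nth (0, 0)%N sigma i) = unordered (nth (0, 0)%N Z (nth 0%N pos i)).
  move=> iN; rewrite -(nth_map _ (0, 0)%N) // posE.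
  rewrite (nth_map 0%N) ?(perm_size pm_pos) ?size_iota //.
  by rewrite (nth_map (0, 0)%N) // ltZ.
rewrite -incident_unordered !unE // incident_unordered.
move: (ltZ s sn) (ltZ t tn); move: (nth 0%N pos s) (nth 0%N pos t) => i j.
rewrite /Z size_zip size_behead => iZ jZ.
rewrite !nth_zip_cond size_zip size_behead iZ jZ /incident /= !nth_behead.
have [i1 j1] : (i.+1 < size vs)%N /\ (j.+1 < size vs)%N by lia.
by rewrite !(nth_uniq 0%N) ?(ltnW i1, ltnW j1) //; lia.
Qed.

(** Alternating the two colors by parity of the position colors every edge. *)
Lemma OPT_path (sigma : seq edge) (pos : seq nat) :
  arrival_order sigma pos -> OPT 2 sigma = size sigma.
Proof.
move=> ao; apply/eqP; rewrite eqn_leq; apply/andP; split.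
  by apply/bigmax_leqP => c _; apply: leq_trans (max_card _) _; rewrite card_ord.
pose c := [ffun i : 'I_(size sigma) =>
  Some (if odd (nth 0%N pos i) then color2 else color1)].
have pc : proper_coloring c.
  apply/forallP => i; apply/forallP => j; apply/implyP => /and3P[ij _].
  rewrite !(tnth_nth (0, 0)%N) /= ao.2 // !ffunE => adj.
  have : nth 0%N pos i != nth 0%N pos j.
    apply: contraNneq ij => eq; apply/eqP/val_inj => /=.
    by rewrite -(arrival_nth _ _ i ao) // eq (arrival_nth _ _ j ao).
  move=> neq; suff : odd (nth 0%N pos i) != odd (nth 0%N pos j).
    by case: (odd _); case: (odd _).
  have [->|->] : nth 0%N pos i = (nth 0%N pos j).+1 \/
                 nth 0%N pos j = (nth 0%N pos i).+1 by lia.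
    by rewrite /=; case: (odd _).
  by rewrite /=; case: (odd _).
apply: leq_trans (leq_bigmax_cond _ pc).
rewrite -[leqLHS](card_ord (size sigma)); apply/subset_leq_card/fintype.subsetP => i _.
by rewrite inE ffunE.
Qed.

(** * Lower bound on the competitive ratio *)

Definition ratio {R : realType} (p : R) : R :=
  Num.min (p ^+ 2 - p + 1) (2 / 3 * (- p ^+ 2 + p + 1)).

Lemma reject_prob2 {R : realType} (p : R) :
  reject_prob p 2 = 2 * (1 - (p ^+ 2 - p + 1)).
Proof. by rewrite /reject_prob; field. Qed.

Lemma reject_prob3 {R : realType} (p : R) :
  reject_prob p 3 = 3 * (1 - 2 / 3 * (- p ^+ 2 + p + 1)).
Proof. by rewrite /reject_prob; field. Qed.

(** The left side depends only on the parity of [d] and the right side grows with [d], so the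
    smallest even and odd distances, 2 and 3, decide; they give the two terms of [ratio]. *)
Lemma reject_prob_le {R : realType} (p : R) (d : nat) :
  0 <= p -> p <= 1 -> (1 < d)%N -> reject_prob p d <= (1 - ratio p) * d%:R.
Proof.
move=> p0 p1 d1.
have r2 : ratio p <= p ^+ 2 - p + 1 by rewrite /ratio ge_min lexx.
have r3 : ratio p <= 2 / 3 * (- p ^+ 2 + p + 1) by rewrite /ratio ge_min lexx orbT.
have -> : reject_prob p d = reject_prob p (if odd d then 3 else 2).
  by rewrite /reject_prob -signr_odd -[in RHS]signr_odd; case: (odd d).
case: ifP => od.
- have d3 : 3%:R <= d%:R :> R by rewrite ler_nat; case: d d1 od => [|[|[|]]].
  rewrite reject_prob3; nra.
- have d2 : 2%:R <= d%:R :> R by rewrite ler_nat.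
  rewrite reject_prob2; nra.
Qed.

Lemma RP_competitive {R : realType} (p : R) :
  0 <= p -> p <= 1 -> competitive path_input (RP p) (ratio p).
Proof.
move=> p0 p1; exists 0 => sigma /path_input_arrival_order [pos ao].
rewrite subr0 (OPT_path _ _ ao) (expected_RP p _ _ p0 p1 ao).
set T := arrival pos; set n := size sigma.
have le1 : 0 <= 1 - ratio p.
  by rewrite /ratio subr_ge0 ge_min; apply/orP; left; nra.
suff S : \sum_(0 <= j < n | peak T j) reject_prob p (rroot T n j - lroot T j) <=
    (1 - ratio p) * n%:R by lra.
apply: (@le_trans _ _ ((1 - ratio p) *
   (\sum_(0 <= j < n | peak T j) (rroot T n j - lroot T j))%N%:R)); last first.
  by rewrite ler_wpM2l // ler_nat sum_rroot_lroot.
rewrite natr_sum mulr_sumr big_nat_cond [leRHS]big_nat_cond.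
apply: ler_sum => j /andP[/andP[_ jn] /andP[uj dj]].
(* The feet lie strictly on either side of the peak, hence at distance at least 2. *)
apply: reject_prob_le => //; rewrite lrootE uj rrootE // dj.
have := lroot_le T j.-1; have := rroot_ge T n j.+1.
by case/andP: uj; lia.
Qed.

(** * Periodic inputs and the upper bound *)

(* Sorting positions by this key reveals them by increasing residue modulo [D],
   so that the peaks are at the residue [D - 1] and their feet are the
   surrounding multiples of [D]. *)
Definition block_key (D n a : nat) : nat := (a %% D * n + a)%N.

(** With [m * D + 1] positions the path begins and ends at a multiple of [D], so for [D > 1] each of
    the [m] blocks has a peak with both feet. *)
Definition block_order (D m : nat) : seq nat :=
  let n := (m * D).+1 in
  sort (fun a b => block_key D n a <= block_key D n b)%N (iota 0 n).

Definition block_input (D m : nat) : seq edge :=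
  [seq (j, j.+1) | j <- block_order D m].

Lemma block_input_path (D m : nat) : path_input (block_input D m).
Proof.
set n := (m * D).+1; exists (iota 0 n.+1); first exact: iota_uniq.
have zipE k i : zip (iota i k.+1) (iota i.+1 k) =
                [seq (j, j.+1) | j <- iota i k].
  by elim: k i => //= k IH i; rewrite -IH.
rewrite -[behead _]/(iota 1 n) zipE.
by apply/perm_map/perm_map; rewrite perm_sort.
Qed.

Lemma size_block_input (D m : nat) : size (block_input D m) = (m * D).+1.
Proof. by rewrite size_map size_sort size_iota. Qed.

Lemma block_arrival_order (D m : nat) :
  arrival_order (block_input D m) (block_order D m).
Proof.
split; first by rewrite size_block_input perm_sort.
move=> s t; rewrite {1 2}/block_input !size_map => sn tn.
by rewrite !(nth_map 0%N) // /incident /=; lia.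
Qed.

(** From [j] to [j.+1] the residue grows by one, except that it resets to 0 when [D] divides [j.+1];
    the factor [n] makes the residue dominate the key. *)
Lemma block_arrival_lt (D m j : nat) : (1 < D)%N -> (j < m * D)%N ->
  (arrival (block_order D m) j < arrival (block_order D m) j.+1)%N =
  ~~ (D %| j.+1)%N /\
  (arrival (block_order D m) j.+1 < arrival (block_order D m) j)%N =
  (D %| j.+1)%N.
Proof.
move=> D1 jm; set n := (m * D).+1; set T := arrival _.
have key a b : (a < n)%N -> (b < n)%N -> (T a < T b)%N ->
    (block_key D n a <= block_key D n b)%N.
  pose leK := relpre (block_key D n) leq.
  have leK_trans : transitive leK by move=> y x z; apply: leq_trans.
  have leK_total : total leK by move=> x y; apply: leq_total.
  move=> an bn; apply: (sorted_ltn_index leK_trans (sort_sorted leK_total _));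
    by rewrite mem_sort mem_iota.
have neq : T j != T j.+1.
  apply/eqP => eq; have ao := block_arrival_order D m.
  have := nth_arrival _ _ j ao; have := nth_arrival _ _ j.+1 ao.
  by rewrite size_block_input -/T eq; lia.
have lt_or : (T j < T j.+1)%N \/ (T j.+1 < T j)%N by lia.
have := key j j.+1 ltac:(lia) ltac:(lia); have := key j.+1 j ltac:(lia) ltac:(lia).
rewrite /block_key (modnS j); case: ifP => dv; last by split; nia.
have : (0 < j %% D)%N.
  rewrite lt0n; apply/negP => dj; have : (D %| 1)%N by rewrite -(dvdn_addr 1 dj) addn1.
  by rewrite dvdn1; lia.
by move=> jD; split; nia.
Qed.

Lemma block_up (D m j : nat) : (1 < D)%N -> (j <= m * D)%N ->
  up (arrival (block_order D m)) j = ~~ (D %| j)%N.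
Proof.
move=> D1; case: j => [|j] jm; first by rewrite dvdn0.
by rewrite /up /= (block_arrival_lt D m j D1 jm).1.
Qed.

Lemma block_down (D m j : nat) : (1 < D)%N -> (j <= m * D)%N ->
  down (arrival (block_order D m)) j = (D %| j.+1)%N.
Proof.
move=> D1; rewrite leq_eqVlt => /predU1P[->|jm]; last first.
  exact: (block_arrival_lt D m j D1 jm).2.
(* At the last position both sides are false, the left one by the sentinel time. *)
have -> : (D %| (m * D).+1)%N = false.
  by rewrite -addn1 dvdn_addr ?dvdn_mull // dvdn1 (gtn_eqF D1).
have := arrival_last _ _ (m * D) (block_arrival_order D m).
by rewrite size_block_input /down; lia.
Qed.

Lemma block_lroot (D m q r : nat) : (1 < D)%N -> (r < D)%N ->
  (q * D + r <= m * D)%N ->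
  lroot (arrival (block_order D m)) (q * D + r) = (q * D)%N.
Proof.
move=> D1; elim: r => [|r IH] rD qm; rewrite lrootE block_up //.
  by rewrite addn0 dvdn_mull.
rewrite dvdn_addr ?dvdn_mull // gtnNdvd //= addnS /= IH //; lia.
Qed.

Lemma block_reject (R : realType) (p : R) (D m : nat) : (1 < D)%N ->
  let T := arrival (block_order D m) in
  \sum_(0 <= j < (m * D).+1 | peak T j)
     reject_prob p (rroot T (m * D).+1 j - lroot T j) =
  m%:R * reject_prob p D.
Proof.
(* From here the period is [D.+1], so the peaks have residue [D]. *)
move=> D1 T; case: D D1 @T => // D D1 T.
have term q r : (r < D.+1)%N -> (q * D.+1 + r <= m * D.+1)%N ->
    (if peak T (q * D.+1 + r)%N then
       reject_prob p (rroot T (m * D.+1).+1 (q * D.+1 + r) -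
                      lroot T (q * D.+1 + r)) else 0) =
    if r == D then reject_prob p D.+1 else 0.
  move=> rD qm; rewrite /peak block_up // block_down //.
  rewrite -addnS !dvdn_addr ?dvdn_mull //.
  have [rE|rD'] := eqVneq r D; last by rewrite [(_ %| r.+1)%N]gtnNdvd ?andbF //; lia.
  subst r; rewrite dvdnn gtnNdvd //=.
  have lt : (q.+1 * D.+1 <= m * D.+1)%N.
    have : (q * D.+1 < m * D.+1)%N by lia.
    by rewrite ltn_pmul2r // => qm'; rewrite leq_mul2r qm' orbT.
  rewrite block_lroot // rrootE; last lia.
  rewrite block_down //.
  rewrite -addnS -{1}mulSnr dvdn_mull // -mulSnr.
  have nd : (D.+1 %| (q.+1 * D.+1).+1)%N = false.
    by rewrite -[(_ * _).+1]addn1 dvdn_addr ?dvdn_mull // dvdn1 gtn_eqF.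
  rewrite rrootE // block_down // nd; congr reject_prob; lia.
(* The final position has residue 0 and contributes nothing; what remains splits into [m] full
   blocks. *)
rewrite big_mkcond big_nat_recr //=.
have := term m 0%N isT; rewrite addn0 => -> //; rewrite ltn_eqF // addr0.
rewrite big_nat_mul mulr_natl -[m in RHS]subn0 -sumr_const_nat.
rewrite big_nat [RHS]big_nat; apply: eq_bigr => q /andP[_ qm].
rewrite -{1}[(q * D.+1)%N]add0n big_addn mulSn addnK big_nat_recr //=.
have le r : (r < D.+1)%N -> (q * D.+1 + r <= m * D.+1)%N.
  by nia.
rewrite addnC term ?le // eqxx big_nat big1 ?add0r // => r /andP[_ rD].
by rewrite addnC term ?le ?ltn_eqF //; lia.
Qed.

(** Otherwise each block would add a fixed deficit [g], and enough blocks would exceed any additive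
    constant. *)
Lemma RP_block_bound {R : realType} (p C : R) (D : nat) :
  0 <= p -> p <= 1 -> (1 < D)%N ->
  competitive path_input (RP p) C -> C * D%:R <= D%:R - reject_prob p D.
Proof.
move=> p0 p1 D1 [b Cb]; rewrite leNgt; apply/negP => lt.
set g := C * D%:R - (D%:R - reject_prob p D).
have g0 : 0 < g by rewrite subr_gt0.
(* The summand [1 - C] comes from the one edge beyond the [m] blocks. *)
have bound m : m%:R * g <= 1 - C + b.
  have := Cb _ (block_input_path D m).
  have ao := block_arrival_order D m.
  rewrite (OPT_path _ _ ao) (expected_RP p _ _ p0 p1 ao) size_block_input.
  by rewrite block_reject // -natr1 natrM /g; lra.
have := bound (Num.trunc ((1 - C + b) / g)).+1.
by rewrite -ler_pdivlMr // leNgt truncnS_gt.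
Qed.

Theorem theorem1 (R : realType) (p : R) (hp2 : 1 / 2 <= p) (hp1 : p <= 1) :
  competitive_ratio path_input (RP p) =
  (Num.min (p ^+ 2 - p + 1) (2 / 3 * (- p ^+ 2 + p + 1)))%:E.
Proof.
have p0 : 0 <= p by lra.
apply/eqP; rewrite eq_le; apply/andP; split.
(* The periods 2 and 3 bound [C] by the two terms of the minimum. *)
- apply/ereal_supP => _ [C compC <-]; rewrite lee_fin le_min.
  have := RP_block_bound p C 2 p0 hp1 isT compC.
  have := RP_block_bound p C 3 p0 hp1 isT compC.
  rewrite reject_prob2 reject_prob3 => h3 h2; apply/andP; split; lra.
- apply: ereal_sup_ubound; exists (ratio p) => //.
  exact: RP_competitive.
Qed.
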